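(* Let $p>1$. If $\alpha>0$, $0<\beta<\pi_p/2$ and $\cosh_p\alpha\cdot\cos_p\beta=1$, then \[ \int_0^\alpha \frac{x\,dx}{\cosh_p^{p-1}x}+\int_0^\beta \frac{y\,dy}{\cos_p^{p-1}y}=\alpha\beta. \]
   Context: Let $\pi_p=2\int_0^1\frac{dt}{(1-t^p)^{1/p}}$. The generalized trigonometric functions $\sin_p,\cos_p$ on $[0,\pi_p/2]$ are the (nonnegative) functions defined by \[ \frac{d}{dx}\sin_px=\cos_px,\qquad \sin_p^px+\cos_p^px=1,\qquad \sin_p0=0, \] so that $\sin_p$ on $[0,\pi_p/2]$ is the inverse of $s\mapsto\int_0^s(1-t^p)^{-1/p}dt$, $s\in[0,1]$. The generalized hyperbolic functions $\sinh_p,\cosh_p$ on $[0,\infty)$ are the (nonnegative) functions defined by \[ \frac{d}{dx}\sinh_px=\cosh_px,\qquad \cosh_p^px-\sinh_p^px=1,\qquad \sinh_p0=0, \] so that $\sinh_p$ is the inverse of $s\mapsto\int_0^s(1+t^p)^{-1/p}dt$, $s\ge0$. Notation: $\cos_p^{q}x=(\cos_px)^q$, and similarly for the other functions. *)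

(* Defs.v *)
From HB Require Import structures.
From mathcomp Require Import all_boot all_order all_algebra.
From mathcomp Require Import all_classical all_reals all_analysis.

Set Implicit Arguments.
Unset Strict Implicit.
Unset Printing Implicit Defensive.

Import Order.TTheory GRing.Theory Num.Theory.
Import numFieldNormedType.Exports.

Local Open Scope classical_set_scope.
Local Open Scope ring_scope.

Section GeneralizedTrigonometric.
Context {R : realType}.
Local Notation mu := (@lebesgue_measure R).
Implicit Types p s x : R.

(* The integrand is unbounded near 1, but Lebesgue integrable on [0, 1] when
   p > 1; at t = 1 itself (a null set) it takes the junk value 0. *)
Definition arcsinp p s : R :=
  \int[mu]_(t in `[0, s]) ((1 - t `^ p) `^ p^-1)^-1.

Definition pip p : R := 2 * arcsinp p 1.

(* Inverse of the increasing bijection arcsinp p : [0, 1] -> [0, pip p / 2];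
   only meaningful on [0, pip p / 2]. *)
Definition sinp p : R -> R := 'pinv_(fun=> 0) `[0, 1] (arcsinp p).

(* The nonnegative solution of sinp^p + cosp^p = 1. It is the derivative of
   sinp, since arcsinp' (s) = 1 / (1 - s^p)^(1/p). *)
Definition cosp p x : R := (1 - sinp p x `^ p) `^ p^-1.

Definition arcsinhp p s : R :=
  \int[mu]_(t in `[0, s]) ((1 + t `^ p) `^ p^-1)^-1.

(* Inverse of the increasing bijection arcsinhp p : [0, +oo[ -> [0, +oo[;
   only meaningful on [0, +oo[. *)
Definition sinhp p : R -> R := 'pinv_(fun=> 0) `[0, +oo[ (arcsinhp p).

(* The nonnegative solution of coshp^p - sinhp^p = 1. It is the derivative of
   sinhp, since arcsinhp' (s) = 1 / (1 + s^p)^(1/p). *)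
Definition coshp p x : R := (1 + sinhp p x `^ p) `^ p^-1.

End GeneralizedTrigonometric.

(* Main.v *)
Require Import Defs.
From mathcomp Require Import all_boot all_order all_algebra.
From mathcomp Require Import all_classical all_reals all_analysis.
From mathcomp Require Import measurable_realfun ring lra.

Import Order.TTheory GRing.Theory Num.Theory.
Import numFieldNormedType.Exports.

Local Open Scope classical_set_scope.
Local Open Scope ring_scope.

(** Both integrals are taken over one parameter [s = sinh_p x = tan_p y]. Since
    [cos_p y = (1 + tan_p^p y)^(-1/p)], the relation
    [cosh_p alpha * cos_p beta = 1] says exactly that the same value
    [S = sinh_p alpha = tan_p beta] is reached at the two upper endpoints. Write
    [w = 1 + s^p]. Then [x = A(s)] and [y = B(s)], where
    [A = arcsinh_p] and [B = arctan_p] are the primitives of [w^(-1/p)] and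
    [w^(-1)] that vanish at 0, while [cosh_p x = w^(1/p)] and
    [cos_p y = w^(-1/p)]. Hence
      [x dx / cosh_p^(p-1) x = A w^(-(p-1)/p) w^(-1/p) ds = A B' ds],
      [y dy / cos_p^(p-1) y = B w^((p-1)/p) w^(-1) ds = B A' ds],
    and the sum of the two integrals is the integral of [(A B)'] over [0, S],
    that is [A(S) B(S) = alpha beta].

    The two changes of variables are [integral_coshp] and [integral_cosp]. The
    second one needs [B] expressed through [arcsin_p]:
    [arcsin_p (sin_p y) = arctan_p (tan_p y)] is itself a change of variables
    ([arcsinp_sin_of_tan]). Continuity of [cosh_p] and [cos_p], which the
    substitutions require, comes from the continuity of the inverse of a
    continuous injection on a segment.

    Two facts are read off the hypotheses instead of being computed. The
    improper integral [arcsin_p 1] converges: a divergent nonnegative integral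
    has real value 0, whereas [0 < beta < pi_p / 2]. And [alpha] is a value of
    [arcsinh_p]: otherwise [sinh_p alpha] would be the default 0, and the
    relation would force [beta = 0]. *)

(** * Inverses of functions on a subset *)

Section PartialInverse.
Context {R : realType}.
Implicit Types (A : set R) (f : R -> R) (y : R).

Lemma pinv_default A f d y : ~ (f @` A) y -> 'pinv_(fun=> d) A f y = d.
Proof.
by move=> fAy; rewrite /pinv_ /inv; cbn; case: pselect.
Qed.

Lemma pinv_mem_or_default A f d y :
  A ('pinv_(fun=> d) A f y) \/ 'pinv_(fun=> d) A f y = d.
Proof.
have [fAy|] := pselect ((f @` A) y); last by right; exact: pinv_default.
left; have : [set 'pinv_(fun=> d) A f x | x in f @` A] `<=` A.
  by apply: surjpinv_image_sub => z; exact.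
by apply; exists y.
Qed.

End PartialInverse.

(** * Continuity on a subset *)

Section WithinContinuous.
Context {R : realType}.
Implicit Types (A : set R) (f g : R -> R) (r : R).

Lemma eq_within_continuous A f g :
  {in A, f =1 g} -> {within A, continuous f} -> {within A, continuous g}.
Proof. by move=> fg cf; exact: (subspace_eq_continuous (f := f)). Qed.

Lemma within_continuous_id A : {within A, continuous (@idfun R)}.
Proof. by apply: continuous_subspaceT => x; exact: cvg_id. Qed.

Lemma within_continuousV A f : (forall x, A x -> f x != 0) ->
  {within A, continuous f} -> {within A, continuous (fun x => (f x)^-1)}.
Proof.
move=> f0 cf; apply: (within_continuous_comp A f GRing.inv) => //.
by move=> _ /set_mem[x Ax <-]; apply: inv_continuous; exact: f0.
Qed.

Lemma within_continuous_mul A f g : {within A, continuous f} ->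
  {within A, continuous g} -> {within A, continuous (fun x => f x * g x)}.
Proof. by move=> cf cg x; apply: continuousM; [exact: cf|exact: cg]. Qed.

Lemma within_continuous_cstD A f r : {within A, continuous f} ->
  {within A, continuous (fun x => r + f x)}.
Proof. by move=> cf x; apply: continuousD; [exact: cst_continuous|exact: cf]. Qed.

Lemma within_continuous_cstB A f r : {within A, continuous f} ->
  {within A, continuous (fun x => r - f x)}.
Proof. by move=> cf x; apply: continuousB; [exact: cst_continuous|exact: cf]. Qed.

Lemma continuous_powR_gt0 r (x : R) : 0 < x -> {for x, continuous (@powR R ^~ r)}.
Proof.
move=> x0; apply: differentiable_continuous; apply/derivable1_diffP.
by apply: derivable_powR; rewrite in_itv/= x0.
Qed.

(** Because [x `^ r] takes the value 1 at every [x < 0], it is not continuous at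
    0; composing with the norm repairs this without changing the values at
    nonnegative arguments. *)
Lemma continuous_norm_powR r : 0 < r -> continuous (fun x : R => `|x| `^ r).
Proof.
move=> r0 x; have [->|x0] := eqVneq x 0.
  rewrite /continuous_at normr0 powR0 ?gt_eqF//; apply/cvgr0Pnorm_lt => e e0.
  near=> y; rewrite ger0_norm ?powR_ge0//.
  have : `|y| < e `^ r^-1.
    by near: y; apply: cvgr0_norm_lt => //; exact: powR_gt0.
  move=> /(gt0_ltr_powR r0); rewrite !nnegrE => /(_ (normr_ge0 _) (powR_ge0 _ _)).
  by rewrite -powRrM mulVf ?gt_eqF// powRr1// ltW.
suff : {for x, continuous ((@powR R ^~ r) \o (fun y : R => `|y|))} by [].
apply: continuous_comp; first exact: norm_continuous.
by apply: continuous_powR_gt0; rewrite normr_gt0.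
Unshelve. all: by end_near. Qed.

Lemma within_continuous_powR A f r : 0 < r -> (forall x, A x -> 0 <= f x) ->
  {within A, continuous f} -> {within A, continuous (fun x => f x `^ r)}.
Proof.
move=> r0 f0 cf; apply: (@eq_within_continuous _ (fun x => `|f x| `^ r)).
  by move=> x /set_mem Ax; rewrite ger0_norm// f0.
apply: (within_continuous_comp A f (fun y => `|y| `^ r)) => //.
by move=> y _; exact: continuous_norm_powR.
Qed.

Lemma within_continuous_powR_gt0 A f r : (forall x, A x -> 0 < f x) ->
  {within A, continuous f} -> {within A, continuous (fun x => f x `^ r)}.
Proof.
move=> f0 cf; apply: (within_continuous_comp A f (@powR R ^~ r)) => //.
by move=> _ /set_mem[x Ax <-]; apply: continuous_powR_gt0; exact: f0.
Qed.

End WithinContinuous.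

(** * Primitives and change of variables *)

Section IntegralAsAntiderivative.
Context {R : realType}.
Local Notation mu := (@lebesgue_measure R).
Implicit Types (f g F G : R -> R) (a b : R).

Lemma within_continuous_integrable {f a b} : {within `[a, b], continuous f} ->
  mu.-integrable `[a, b] (EFin \o f).
Proof.
by apply: continuous_compact_integrable; exact: segment_compact.
Qed.

Lemma is_derive_antiderivative f a b x : mu.-integrable `[a, b] (EFin \o f) ->
  x \in `]a, b[ -> {for x, continuous f} ->
  is_derive x 1 (fun s => \int[mu]_(t in `[a, s]) f t) (f x).
Proof.
move=> fi; rewrite in_itv/= => /andP[ax xb] fx.
have [dF F'] := continuous_FTC1_closed xb fi ax fx.
by split; [exact: dF|rewrite -derive1E; exact: F'].
Qed.

Lemma antiderivative_lt f a b : a < b -> mu.-integrable `[a, b] (EFin \o f) ->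
  {in `]a, b[, continuous f} -> {in `]a, b[, forall x, 0 < f x} ->
  {in `[a, b] &, {homo (fun s => \int[mu]_(t in `[a, s]) f t) : x y / x < y}}.
Proof.
move=> ab fi cf f0.
have D x : x \in `]a, b[ ->
    is_derive x 1 (fun s => \int[mu]_(t in `[a, s]) f t) (f x).
  by move=> xab; apply: (@is_derive_antiderivative f a b) => //; exact: cf.
apply: gtr0_derive1_lt_cc.
- by move=> x /D [].
- by move=> x xab; have [_ F'x] := D x xab; rewrite derive1E F'x; exact: f0.
- exact: (parameterized_integral_continuous (ltW ab) fi).
Qed.

Lemma within_derive_LRcontinuous {F f a b} : a < b ->
  {within `[a, b], continuous F} ->
  (forall x, x \in `]a, b[ -> is_derive x 1 F (f x)) ->
  derivable_oo_LRcontinuous F a b /\ {in `]a, b[, derive1 F =1 f}.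
Proof.
move=> ab /(continuous_within_itvP _ ab)[_ Fa Fb] D; split.
  by split => // x /D [].
by move=> x /D [_ F'x]; rewrite derive1E.
Qed.

(** The derivative of [F] is given by a function [f] that is continuous up to the
    endpoints, which supplies the limits of [F'] there; [h] stands for the
    transformed integrand, so that its measurability follows from its
    continuity. *)
Lemma Rintegral_substitution F f G h a b : a < b ->
  {within `[a, b], continuous F} -> {within `[a, b], continuous f} ->
  (forall x, x \in `]a, b[ -> is_derive x 1 F (f x)) ->
  {in `]a, b[, forall x, 0 < f x} ->
  {within `[F a, F b], continuous G} -> {within `[a, b], continuous h} ->
  {in `]a, b[, forall x, G (F x) * f x = h x} ->
  \int[mu]_(y in `[F a, F b]) G y = \int[mu]_(x in `[a, b]) h x.
Proof.
move=> ab cF cf D f0 cG ch GFh.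
have [LR F'f] := within_derive_LRcontinuous ab cF D.
have /(continuous_within_itvP _ ab)[cfo fa fb] := cf.
rewrite /Rintegral (@integration_by_substitution_increasing _ F G a b) //.
- have F'h : {in `]a, b[, h =1 (G \o F) * derive1 F}.
    by move=> x xab; rewrite -GFh//= -F'f.
  have mh : measurable_fun `]a, b[ h.
    have /measurable_int/measurable_EFinP := within_continuous_integrable ch.
    by apply: measurable_funS => //; exact: subset_itv_oo_cc.
  congr fine; apply/esym/eq_integral_itv_bounded => //.
  by apply: eq_measurable_fun mh => x /set_mem; exact: F'h.
- exact: ltW.
- apply: gtr0_derive1_lt_cc => //; first by move=> x /D [].
  by move=> x xab; rewrite F'f ?f0.
- move=> x xab; rewrite /continuous_at F'f//.
  apply: cvg_trans (cfo _ xab); apply: near_eq_cvg.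
  near=> y; rewrite F'f//; near: y; exact: near_in_itvoo.
- apply/cvg_ex; exists (f a); apply: cvg_trans fa; apply: near_eq_cvg.
  by near=> y; rewrite F'f// in_itv/=; apply/andP; split.
- apply/cvg_ex; exists (f b); apply: cvg_trans fb; apply: near_eq_cvg.
  by near=> y; rewrite F'f// in_itv/=; apply/andP; split.
Unshelve. all: by end_near. Qed.

End IntegralAsAntiderivative.

(** * Generalized trigonometric and hyperbolic functions *)

Section GeneralizedTrigonometricFacts.
Context {R : realType} {p : R} (p1 : 1 < p).
Local Notation mu := (@lebesgue_measure R).
Local Notation w s := (1 + s `^ p).
Implicit Types q r s x y : R.

Let p0 : 0 < p. Proof. exact: lt_trans p1. Qed.
Let pn0 : p != 0. Proof. by rewrite gt_eqF. Qed.
Let ip0 : 0 < p^-1. Proof. by rewrite invr_gt0. Qed.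

Lemma powR_lt1 x : 0 <= x -> x < 1 -> x `^ p < 1.
Proof.
by move=> x0 /(gt0_ltr_powR p0); rewrite !nnegrE powR1; exact.
Qed.

Lemma powR_le1 x : 0 <= x -> x <= 1 -> x `^ p <= 1.
Proof.
by move=> x0 /(ge0_ler_powR (ltW p0)); rewrite !nnegrE powR1; exact.
Qed.

Lemma onepow_gt0 s : 0 < w s.
Proof. by rewrite ltr_pwDl// powR_ge0. Qed.

Lemma onepow_powRD s q r : (w s) `^ q * (w s) `^ r = (w s) `^ (q + r).
Proof. by rewrite powRD// (gt_eqF (onepow_gt0 s)) implybT. Qed.

Lemma within_continuous_onepow r s :
  {within `[0, s], continuous (fun x => (w x) `^ r)}.
Proof.
apply: within_continuous_powR_gt0; first by move=> x _; exact: onepow_gt0.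
apply/within_continuous_cstD/within_continuous_powR => //.
  by move=> x /=; rewrite in_itv/= => /andP[].
exact: within_continuous_id.
Qed.

Lemma continuous_onepow r s x : x \in `]0, s[ ->
  {for x, continuous (fun y => (w y) `^ r)}.
Proof.
move=> xs; have : 0 < s by move: xs; rewrite in_itv/= => /andP[]; exact: lt_trans.
move=> /within_continuous_continuous; apply => //.
exact: within_continuous_onepow.
Qed.

(** The common form of the inverse functions: [arcsinh_p] is the case
    [r = - 1 / p] and [arctan_p] is the case [r = - 1]. *)
Definition onepow_primitive r s := \int[mu]_(t in `[0, s]) (w t) `^ r.

Lemma onepow_primitive0 r : onepow_primitive r 0 = 0.
Proof. by rewrite /onepow_primitive set_itv1 Rintegral_set1. Qed.

Lemma is_derive_onepow_primitive r s x : x \in `]0, s[ ->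
  is_derive x 1 (onepow_primitive r) ((w x) `^ r).
Proof.
move=> xs; apply: (@is_derive_antiderivative _ _ 0 s) => //.
  exact/within_continuous_integrable/within_continuous_onepow.
exact: continuous_onepow xs.
Qed.

Lemma within_continuous_onepow_primitive r s : 0 <= s ->
  {within `[0, s], continuous (onepow_primitive r)}.
Proof.
move=> s0; apply: parameterized_integral_continuous => //.
exact/within_continuous_integrable/within_continuous_onepow.
Qed.

Lemma onepow_primitive_lt r s : 0 < s ->
  {in `[0, s] &, {homo onepow_primitive r : x y / x < y}}.
Proof.
move=> s0; apply: antiderivative_lt => //.
- exact/within_continuous_integrable/within_continuous_onepow.
- by move=> x; exact: continuous_onepow.
- by move=> x _; rewrite powR_gt0 ?onepow_gt0.
Qed.

Lemma integral_onepow_primitive q r s : 0 < s ->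
  (\int[mu]_(x in `[0, s]) (onepow_primitive q x * (w x) `^ r)) +
  (\int[mu]_(x in `[0, s]) (onepow_primitive r x * (w x) `^ q)) =
  onepow_primitive q s * onepow_primitive r s.
Proof.
move=> s0.
have [Lq Dq] := within_derive_LRcontinuous s0
  (within_continuous_onepow_primitive q s (ltW s0))
  (is_derive_onepow_primitive q s).
have [Lr Dr] := within_derive_LRcontinuous s0
  (within_continuous_onepow_primitive r s (ltW s0))
  (is_derive_onepow_primitive r s).
rewrite (Rintegration_by_parts s0 _ Lq Dq _ Lr Dr).
- rewrite !onepow_primitive0 mul0r subr0.
  under [X in _ + X]eq_Rintegral => x _ do rewrite mulrC.
  by rewrite subrK.
- exact: within_continuous_onepow.
- exact: within_continuous_onepow.
Qed.

(** ** Hyperbolic functions *)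

Lemma arcsinhpE : arcsinhp p = onepow_primitive (- p^-1).
Proof.
by apply/funext => s; apply: eq_Rintegral => x _; rewrite powRN.
Qed.

Lemma arcsinhp_inj : {in `[0, +oo[%classic &, injective (arcsinhp p)}.
Proof.
move=> x y /set_mem/=; rewrite in_itv/= andbT => x0.
move=> /set_mem/=; rewrite in_itv/= andbT => y0 xy.
have lt u v : 0 <= u -> u < v -> arcsinhp p u < arcsinhp p v.
  move=> u0 uv; rewrite arcsinhpE; have v0 := le_lt_trans u0 uv.
  by apply: (onepow_primitive_lt _ _ v0); rewrite ?in_itv/= ?u0 ?lexx ?ltW.
have [xlty|yltx|//] := ltgtP x y.
  by have := lt _ _ x0 xlty; rewrite xy ltxx.
by have := lt _ _ y0 yltx; rewrite xy ltxx.
Qed.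

Lemma sinhpK s : 0 <= s -> sinhp p (arcsinhp p s) = s.
Proof.
move=> s0; apply: (pinvKV _ arcsinhp_inj).
by apply/mem_set; rewrite /= in_itv/= s0.
Qed.

(** Valid for every [x] because the default value of the inverse is 0. *)
Lemma sinhp_ge0 x : 0 <= sinhp p x.
Proof.
rewrite /sinhp.
have [|->//] := pinv_mem_or_default `[0, +oo[ (arcsinhp p) 0 x.
by rewrite /= in_itv/= andbT.
Qed.

Lemma coshp_arcsinhp s : 0 <= s -> coshp p (arcsinhp p s) = (w s) `^ p^-1.
Proof. by move=> s0; rewrite /coshp sinhpK. Qed.

Lemma within_continuous_coshp s : 0 <= s ->
  {within `[0, arcsinhp p s], continuous (coshp p)}.
Proof.
move=> s0; apply: within_continuous_powR => //.
  by move=> x _; exact/ltW/onepow_gt0.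
apply/within_continuous_cstD/within_continuous_powR => //.
  by move=> x _; exact: sinhp_ge0.
rewrite -[X in `[X, _]](onepow_primitive0 (- p^-1)) -arcsinhpE.
apply: segment_can_le_continuous => //.
  by rewrite arcsinhpE; exact: within_continuous_onepow_primitive.
by move=> x; rewrite in_itv/= => /andP[x0 _]; exact: sinhpK.
Qed.

(** With [x = arcsinh_p s], the integrand becomes
    [A w^(-(p-1)/p) w^(-1/p) = A w^(-1)], where [w = 1 + s^p]. *)
Lemma integral_coshp s : 0 < s ->
  \int[mu]_(x in `[0, arcsinhp p s]) (x / coshp p x `^ (p - 1)) =
  \int[mu]_(x in `[0, s]) (onepow_primitive (- p^-1) x * (w x) `^ (- 1)).
Proof.
move=> s0; have A0 := onepow_primitive0 (- p^-1).
have cA := within_continuous_onepow_primitive (- p^-1) s (ltW s0).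
have cG := within_continuous_coshp s (ltW s0).
rewrite arcsinhpE in cG *; rewrite -{1}A0.
apply: (Rintegral_substitution (onepow_primitive (- p^-1))
  (fun x => (w x) `^ (- p^-1)) (fun x => x / coshp p x `^ (p - 1))).
- exact: s0.
- exact: cA.
- exact: within_continuous_onepow.
- by move=> x; exact: is_derive_onepow_primitive.
- by move=> x _; rewrite powR_gt0 ?onepow_gt0.
- rewrite A0; apply: within_continuous_mul; first exact: within_continuous_id.
  apply: within_continuousV.
    by move=> x _; rewrite gt_eqF// !powR_gt0// onepow_gt0.
  apply: within_continuous_powR; first by rewrite subr_gt0.
    by move=> x _; exact: powR_ge0.
  exact: cG.
- by apply: within_continuous_mul; [exact: cA|exact: within_continuous_onepow].
- move=> x; rewrite in_itv/= => /andP[/ltW x0 _].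
  rewrite -arcsinhpE coshp_arcsinhp// -powRN -powRrM -mulrA onepow_powRD.
  by congr (_ * _ `^ _); field.
Qed.

(** ** Trigonometric functions *)

Definition arctanp := onepow_primitive (- 1).

(** [sin_p y] as a function of [s = tan_p y]. *)
Definition sin_of_tan s := s * (w s) `^ (- p^-1).

Lemma sin_of_tan0 : sin_of_tan 0 = 0.
Proof. by rewrite /sin_of_tan mul0r. Qed.

Lemma sin_of_tan_ge0 s : 0 <= s -> 0 <= sin_of_tan s.
Proof. by move=> s0; rewrite mulr_ge0 ?powR_ge0. Qed.

Lemma one_minus_sin_of_tan s : 0 <= s ->
  1 - (sin_of_tan s) `^ p = (w s) `^ (- 1).
Proof.
move=> s0; rewrite powRM ?powR_ge0// -powRrM mulNr mulVf//.
rewrite powR_inv1 ?ltW ?onepow_gt0//.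
by field; rewrite gt_eqF ?onepow_gt0.
Qed.

Lemma sin_of_tan_lt1 s : 0 <= s -> sin_of_tan s < 1.
Proof.
move=> s0; rewrite ltNge; apply/negP => ts.
have : 0 < 1 - (sin_of_tan s) `^ p.
  by rewrite one_minus_sin_of_tan// powR_gt0// onepow_gt0.
move: (ge0_ler_powR (ltW p0) ler01 (sin_of_tan_ge0 _ s0) ts).
by rewrite powR1 subr_gt0 ltNge => ->.
Qed.

Lemma is_derive_sin_of_tan x : 0 < x ->
  is_derive x 1 sin_of_tan ((w x) `^ (- p^-1 - 1)).
Proof.
move=> x0.
have Dw : is_derive x 1 (fun y => w y) (p * x `^ (p - 1)).
  have := is_deriveD (is_derive_cst (1 : R) x 1) (is_derive1_powR p x0).
  by move=> D1; apply: (is_derive_eq D1); rewrite add0r.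
have Dwr := @is_derive1_comp R (@powR R ^~ (- p^-1)) (fun y => w y) x _ _
  (is_derive1_powR (- p^-1) (onepow_gt0 x)) Dw.
have := is_deriveM (is_derive_id x 1) Dwr.
move=> Dt; apply: (is_derive_eq Dt); rewrite /GRing.scale/= mulr1.
have -> : (w x) `^ (- p^-1) = (w x) `^ (- p^-1 - 1) * w x.
  by rewrite -{3}(powRr1 (ltW (onepow_gt0 x))) onepow_powRD subrK.
by rewrite -(mulr_powRB1 (ltW x0) p0); field.
Qed.

Definition arcsinp_integrand x := ((1 - x `^ p) `^ p^-1)^-1.

Lemma arcsinp0 : arcsinp p 0 = 0.
Proof. by rewrite /arcsinp set_itv1 Rintegral_set1. Qed.

Lemma within_continuous_arcsinp_integrand r : r < 1 ->
  {within `[0, r], continuous arcsinp_integrand}.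
Proof.
move=> r1.
have f0 x : `[0, r]%classic x -> 0 < 1 - x `^ p.
  rewrite /= in_itv/= => /andP[x0 xr]; rewrite subr_gt0.
  exact: powR_lt1 (le_lt_trans xr r1).
apply: within_continuousV; first by move=> x /f0 x0; rewrite gt_eqF ?powR_gt0.
apply: within_continuous_powR_gt0 => //.
apply/within_continuous_cstB/within_continuous_powR => //.
  by move=> x /=; rewrite in_itv/= => /andP[].
exact: within_continuous_id.
Qed.

(** The substitution [t = sin_of_tan u] turns [dt / (1 - t^p)^(1/p)] into
    [du / (1 + u^p)]; its upper endpoint stays below 1, so the singularity of
    the integrand is avoided. *)
Lemma arcsinp_sin_of_tan s : 0 <= s -> arcsinp p (sin_of_tan s) = arctanp s.
Proof.
rewrite le_eqVlt => /predU1P[<-|s0].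
  by rewrite sin_of_tan0 arcsinp0 /arctanp onepow_primitive0.
rewrite /arcsinp -{1}sin_of_tan0.
apply: (Rintegral_substitution _ (fun x => (w x) `^ (- p^-1 - 1))
  arcsinp_integrand) => //.
- apply: within_continuous_mul; last exact: within_continuous_onepow.
  exact: within_continuous_id.
- exact: within_continuous_onepow.
- move=> x; rewrite in_itv/= => /andP[x0 _]; exact: is_derive_sin_of_tan.
- by move=> x _; rewrite powR_gt0 ?onepow_gt0.
- rewrite sin_of_tan0; apply: within_continuous_arcsinp_integrand.
  exact/sin_of_tan_lt1/ltW.
- exact: within_continuous_onepow.
- move=> x; rewrite in_itv/= => /andP[/ltW x0 _].
  rewrite /arcsinp_integrand one_minus_sin_of_tan// -powRN -powRrM onepow_powRD.
  by congr (_ `^ _); lra.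
Qed.

(** Valid for every [x] because the default value of the inverse is 0. *)
Lemma sinp_ge0_le1 x : 0 <= sinp p x <= 1.
Proof.
rewrite /sinp; have [|->] := pinv_mem_or_default `[0, 1] (arcsinp p) 0 x.
  by rewrite /= in_itv.
by rewrite lexx ler01.
Qed.

(** The relation reads [(1 + sinh_p^p alpha) (1 - sin_p^p beta) = 1], which
    determines [sin_p beta] from [sinh_p alpha]. *)
Lemma sinp_of_coshp_mul_cosp x y : coshp p x * cosp p y = 1 ->
  sinp p y = sin_of_tan (sinhp p x).
Proof.
rewrite /coshp /cosp.
have [S0 /andP[T0 T1]] := (sinhp_ge0 x, sinp_ge0_le1 y).
move: (sinhp p x) (sinp p y) S0 T0 T1 => S T S0 T0 T1 ST.
have Tp := powR_le1 _ T0 T1.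
have wT0 : 0 <= w S * (1 - T `^ p).
  by rewrite mulr_ge0 ?subr_ge0// ltW// onepow_gt0.
have wT : w S * (1 - T `^ p) = 1.
  have : (w S * (1 - T `^ p)) `^ p^-1 == 1.
    by rewrite powRM ?subr_ge0// ?(ltW (onepow_gt0 _))// ST.
  by rewrite powR_eq1 ltNge wT0 invr_eq0 (gt_eqF p0) /= orbF => /eqP.
apply: (powR_injective p0); rewrite ?nnegrE ?sin_of_tan_ge0//.
have := one_minus_sin_of_tan S S0.
rewrite powR_inv1 ?(ltW (onepow_gt0 S))// => tE.
apply: oppr_inj; apply: (addrI 1); rewrite /= tE.
apply: (mulfI (lt0r_neq0 (onepow_gt0 S))); rewrite wT divff//.
by rewrite lt0r_neq0// onepow_gt0.
Qed.

(** ** Trigonometric functions, given that [arcsin_p 1] is nonzero *)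

Context (pip_gt0 : 0 < pip p).

(** The integrand is nonnegative, so it fails to be integrable only if its
    integral is [+oo]; the real-valued integral is then 0, and so is [pi_p]. *)
Lemma arcsinp_integrable : mu.-integrable `[0, 1] (EFin \o arcsinp_integrand).
Proof.
have mf : measurable_fun [set: measurableTypeR R] arcsinp_integrand.
  rewrite (_ : arcsinp_integrand = fun x => (1 - x `^ p) `^ (- p^-1)); last first.
    by apply/funext => x; rewrite powRN.
  have m1 : measurable_fun [set: measurableTypeR R] (fun x => 1 - x `^ p).
    by apply: measurable_funB => //; exact: measurable_powR.
  exact: (measurableT_comp (measurable_powR (- p^-1)) m1).
apply/integrableP; split; first exact/measurable_EFinP/measurable_funTS.
under eq_integral => x _ do rewrite /= ger0_norm ?invr_ge0 ?powR_ge0//.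
rewrite ltNge leye_eq; apply/eqP => oo.
by move: pip_gt0; rewrite /pip /arcsinp /Rintegral oo /= mulr0 ltxx.
Qed.

Lemma within_continuous_arcsinp : {within `[0, 1], continuous (arcsinp p)}.
Proof.
exact: (parameterized_integral_continuous ler01 arcsinp_integrable).
Qed.

Lemma arcsinp_inj : {in `[0, 1]%classic &, injective (arcsinp p)}.
Proof.
have lt : {in `[0, 1] &, {homo arcsinp p : x y / x < y}}.
  apply: antiderivative_lt => //; first exact: arcsinp_integrable.
  - move=> x; rewrite in_itv/= => /andP[x0 x1].
    have /(_ _)/within_continuous_continuous :=
      within_continuous_arcsinp_integrand ((x + 1) / 2).
    by apply; rewrite ?in_itv/=; lra.
  - move=> x; rewrite in_itv/= => /andP[x0 x1]; rewrite invr_gt0 powR_gt0//.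
    by rewrite subr_gt0 powR_lt1// ltW.
move=> x y /set_mem/= x01 /set_mem/= y01 xy.
have [xlty|yltx|//] := ltgtP x y.
  by have := lt _ _ x01 y01 xlty; rewrite xy ltxx.
by have := lt _ _ y01 x01 yltx; rewrite xy ltxx.
Qed.

Lemma sinpK s : 0 <= s <= 1 -> sinp p (arcsinp p s) = s.
Proof.
move=> s01; apply: (pinvKV _ arcsinp_inj).
by apply/mem_set; rewrite /= in_itv.
Qed.

Lemma cosp_arctanp s : 0 <= s -> cosp p (arctanp s) = (w s) `^ (- p^-1).
Proof.
move=> s0; rewrite -arcsinp_sin_of_tan// /cosp sinpK.
  by rewrite one_minus_sin_of_tan// -powRrM mulN1r.
by rewrite sin_of_tan_ge0//= ltW// sin_of_tan_lt1.
Qed.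

Lemma within_continuous_cosp s : 0 <= s <= 1 ->
  {within `[0, arcsinp p s], continuous (cosp p)}.
Proof.
move=> /andP[s0 s1]; apply: within_continuous_powR => //.
  move=> x _; have /andP[x0 x1] := sinp_ge0_le1 x.
  by rewrite subr_ge0 powR_le1.
apply/within_continuous_cstB/within_continuous_powR => //.
  by move=> x _; have /andP[] := sinp_ge0_le1 x.
rewrite -[X in `[X, _]]arcsinp0; apply: segment_can_le_continuous => //.
  apply: continuous_subspaceW within_continuous_arcsinp.
  by apply: subset_itvl; rewrite bnd_simp.
move=> x; rewrite in_itv/= => /andP[x0 xs]; apply: sinpK.
by rewrite x0 (le_trans xs).
Qed.

(** With [y = arctan_p s], the integrand becomes
    [B w^((p-1)/p) w^(-1) = B w^(-1/p)], where [w = 1 + s^p]. *)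
Lemma integral_cosp s : 0 < s ->
  \int[mu]_(y in `[0, arctanp s]) (y / cosp p y `^ (p - 1)) =
  \int[mu]_(x in `[0, s]) (arctanp x * (w x) `^ (- p^-1)).
Proof.
move=> s0; have B0 : arctanp 0 = 0 := onepow_primitive0 (- 1).
have cB : {within `[0, s], continuous arctanp} :=
  within_continuous_onepow_primitive (- 1) s (ltW s0).
have cosp_gt0 y : `[0, arctanp s]%classic y -> 0 < cosp p y.
  rewrite /= in_itv/= => yB.
  have B_ge0 : arctanp 0 <= arctanp s.
    by rewrite B0; case/andP: yB; exact: le_trans.
  have [|x] := IVT (ltW s0) cB (v := y); first by rewrite min_l// max_r// B0.
  rewrite in_itv/= => /andP[x0 _] <-; rewrite cosp_arctanp//.
  by rewrite powR_gt0// onepow_gt0.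
rewrite -{1}B0.
apply: (Rintegral_substitution arctanp (fun x => (w x) `^ (- 1))
  (fun y => y / cosp p y `^ (p - 1))).
- exact: s0.
- exact: cB.
- exact: within_continuous_onepow.
- by move=> x xs; exact: is_derive_onepow_primitive xs.
- by move=> x _; rewrite powR_gt0 ?onepow_gt0.
- rewrite B0; apply: within_continuous_mul; first exact: within_continuous_id.
  apply: within_continuousV.
    by move=> x /cosp_gt0 x0; rewrite gt_eqF// powR_gt0.
  apply: within_continuous_powR; first by rewrite subr_gt0.
    by move=> x _; exact: powR_ge0.
  rewrite -arcsinp_sin_of_tan ?ltW//; apply: within_continuous_cosp.
  by rewrite sin_of_tan_ge0/= ?ltW// sin_of_tan_lt1// ltW.
- by apply: within_continuous_mul; [exact: cB|exact: within_continuous_onepow].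
- move=> x; rewrite in_itv/= => /andP[/ltW x0 _].
  rewrite cosp_arctanp// -powRN -powRrM -mulrA onepow_powRD.
  by congr (_ * _ `^ _); field.
Qed.

End GeneralizedTrigonometricFacts.

(** * The area identity *)

Theorem proposition13 (R : realType) (p alpha beta : R)
    (hp : 1 < p) (halpha : 0 < alpha)
    (hbeta0 : 0 < beta) (hbeta : beta < pip p / 2)
    (hab : coshp p alpha * cosp p beta = 1) :
  (\int[@lebesgue_measure R]_(x in `[0, alpha]) (x / coshp p x `^ (p - 1)))
  + (\int[@lebesgue_measure R]_(y in `[0, beta]) (y / cosp p y `^ (p - 1)))
  = alpha * beta.
Proof.
have pi0 : 0 < pip p by lra.
have arcsinp1 : arcsinp p 1 = pip p / 2 by rewrite /pip; field.
have [T T01 TE] : exists2 T, T \in `[0, 1] & arcsinp p T = beta.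
  apply: IVT => //; first exact: within_continuous_arcsinp.
  by rewrite arcsinp0 arcsinp1 min_l ?max_r ?ltW//; lra.
rewrite in_itv/= in T01.
pose S := sinhp p alpha; have S0 : 0 <= S := sinhp_ge0 alpha.
have betaE : beta = @arctanp R p S.
  rewrite -arcsinp_sin_of_tan// -(sinp_of_coshp_mul_cosp hp _ _ hab).
  by rewrite -TE sinpK.
have Spos : 0 < S.
  rewrite lt_neqAle S0 andbT; apply/eqP => S00; move: hbeta0.
  by rewrite betaE -S00 /arctanp onepow_primitive0 ltxx.
(* Outside the range of arcsinh_p, sinh_p takes its default value 0. *)
have alphaE : arcsinhp p S = alpha.
  apply: pinvK; apply/mem_set; apply: contrapT => out.
  by move: Spos; rewrite /S /sinhp pinv_default// ltxx.
rewrite -alphaE betaE integral_coshp// integral_cosp// arcsinhpE.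
exact: integral_onepow_primitive.
Qed.
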